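(* Let $G=\{G_n\}_{n\in\mathbb{N}}$ be an ordered mean. Let $\mathbb{A}=[A_{ij}]$ be an $n$-by-$k$ block matrix with $A_{ij}\in\mathbb{P}$ and $0<mI\le A_{ij}\le MI$ for all $i,j$, for some constants $M,m>0$. Let $\omega=(w_1,\dots,w_n)\in\Delta_n$ and $\lambda=(\lambda_1,\dots,\lambda_k)\in\Delta_k$, and put $K=\frac{(M+m)^2}{4Mm}$ and $\omega\bullet\mu=\sum_{i=1}^n w_i\mu_i$ for $\mu=(\mu_1,\dots,\mu_n)$. Then (i) for any $\mu_1,\dots,\mu_n,\nu\ge0$, $$G_n^\nu(\omega;G_k^{\mu_1}(\lambda;\mathbb{A}^1),\dots,G_k^{\mu_n}(\lambda;\mathbb{A}^n))\le K\,G_k^{\omega\bullet\mu}(\lambda;G_n^\nu(\omega;\mathbb{A}_1),\dots,G_n^\nu(\omega;\mathbb{A}_k));$$ (ii) for any $\mu_1,\dots,\mu_n,\nu<0$, $$G_n^\nu(\omega;G_k^{\mu_1}(\lambda;\mathbb{A}^1),\dots,G_k^{\mu_n}(\lambda;\mathbb{A}^n))\ge K^{-1}\,G_k^{\omega\bullet\mu}(\lambda;G_n^\nu(\omega;\mathbb{A}_1),\dots,G_n^\nu(\omega;\mathbb{A}_k)).$$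
   Context: Let $\mathcal{H}$ be a Hilbert space and $\mathbb{P}$ the open convex cone of positive invertible bounded linear operators on $\mathcal{H}$; $I$ is the identity. For self-adjoint $A,B$, $A\le B$ means $B-A$ is positive semi-definite (Loewner order). $\Delta_n$ is the set of probability vectors $\omega=(w_1,\dots,w_n)\in\mathbb{R}^n$ with all $w_i>0$ and $\sum_i w_i=1$. An ordered mean is a family $G=\{G_n\}_{n\in\mathbb{N}}$ of maps $G_n:\Delta_n\times\mathbb{P}^n\to\mathbb{P}$ such that for every $n$, all $\mathbf{A},\mathbf{B}\in\mathbb{P}^n$, $\omega\in\Delta_n$ and real $a>0$: (P1) $G_n(\omega;a\mathbf{A})=aG_n(\omega;\mathbf{A})$; (P2) $G_n(\omega;\mathbf{B})\le G_n(\omega;\mathbf{A})$ whenever $B_i\le A_i$ for all $i$; (P3) $G_n(\omega;(1-s)\mathbf{A}+s\mathbf{B})\ge(1-s)G_n(\omega;\mathbf{A})+sG_n(\omega;\mathbf{B})$ for $0\le s\le1$; (P4) $\left[\sum_{i=1}^n w_iA_i^{-1}\right]^{-1}\le G_n(\omega;\mathbf{A})\le\sum_{i=1}^n w_iA_i$. Parameterized ordered mean: for real $\mu\ge0$, $G_n^\mu(\omega;\mathbf{A}):=G_n(\omega;A_1+\mu I,\dots,A_n+\mu I)-\mu I$ (an element of $\mathbb{P}$); for real $\mu<0$, $G_n^\mu(\omega;\mathbf{A}):=G_n^{-\mu}(\omega;A_1^{-1},\dots,A_n^{-1})^{-1}$. For an $n$-by-$k$ block matrix $\mathbb{A}=[A_{ij}]$,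 $\mathbb{A}^i=(A_{i1},\dots,A_{ik})\in\mathbb{P}^k$ denotes its $i$th row and $\mathbb{A}_j=(A_{1j},\dots,A_{nj})\in\mathbb{P}^n$ its $j$th column. *)

(* Defs.v *)
From HB Require Import structures.
From mathcomp Require Import all_boot all_order all_algebra complex.
From mathcomp Require Import all_classical all_reals all_analysis.

Set Implicit Arguments.
Unset Strict Implicit.
Unset Printing Implicit Defensive.

Import Order.TTheory GRing.Theory Num.Theory.
Import numFieldNormedType.Exports.
Local Open Scope complex_scope.
Local Open Scope classical_set_scope.
Local Open Scope ring_scope.

(* Complex Hilbert spaces.  The form hdot is linear in its first argument and
   conjugate-linear in the second; norms, like all norms of R[i]-modules,
   take their (real, nonnegative) values in R[i]. *)
HB.mixin Record isHilbert (R : realType) H of CompleteNormedModule R[i] H := {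
  hdot : {dot H for (@Num.conj R[i])} ;
  hdot_norm : forall x : H, hdot x x = `|x| ^+ 2
}.

#[short(type="hilbertType")]
HB.structure Definition Hilbert (R : realType) :=
  {H of isHilbert R H & CompleteNormedModule R[i] H}.

Section BoundedOperators.
Variables (R : realType) (H : hilbertType R).

Definition bounded_linear (f : H -> H) : Prop :=
  linear f /\ exists r : R, forall x, `|f x| <= r%:C * `|x|.

Definition bounded_linear_pred : pred (H -> H) :=
  fun f => `[< bounded_linear f >].

Record bop := Bop { bop_fun :> H -> H; _ : bounded_linear_pred bop_fun }.

HB.instance Definition _ := [isSub for bop_fun].
HB.instance Definition _ := [Choice of bop by <:].

Lemma bop_linear (A : bop) : linear A.
Proof. by case: A => f /= /asboolP[]. Qed.

Lemma bop_bounded (A : bop) : exists r : R, forall x, `|A x| <= r%:C * `|x|.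
Proof. by case: A => f /= /asboolP[]. Qed.

Lemma bounded_linear_submod : submod_closed bounded_linear_pred.
Proof.
split.
  apply/asboolP; split=> [c x y|]; first by rewrite scaler0 addr0.
  by exists 0 => x; rewrite normr0 mul0r.
move=> c f g /asboolP[fl [r fr]] /asboolP[gl [s gs]]; apply/asboolP; split.
  move=> d x y /=.
  rewrite [LHS](_ : _ = c *: f (d *: x + y) + g (d *: x + y))//.
  rewrite [RHS](_ : _ = d *: (c *: f x + g x) + (c *: f y + g y))//.
  rewrite fl gl !scalerDr !scalerA (mulrC c d) -!addrA; congr (_ + _).
  by rewrite addrCA.
exists (complex.Re `|c| * r + s) => x.
have cE : (complex.Re `|c|)%:C = `|c| by exact: RRe_real (normr_real _).
rewrite [X in `|X|](_ : _ = c *: f x + g x)//.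
rewrite rmorphD rmorphM /= cE mulrDl -mulrA.
rewrite (le_trans (ler_normD _ _))// lerD// normrZ.
by rewrite ler_wpM2l.
Qed.

HB.instance Definition _ :=
  GRing.isSubmodClosed.Build _ _ bounded_linear_pred bounded_linear_submod.
HB.instance Definition _ := [SubChoice_isSubLmodule of bop by <:].

Lemma bop_eqP (A B : bop) : A =1 B -> A = B.
Proof. by move=> AB; apply/val_inj/funext. Qed.

Lemma bop_one_subproof : bounded_linear_pred (@id H).
Proof. by apply/asboolP; split=> //; exists 1 => x; rewrite mul1r. Qed.

Definition bop_one : bop := Bop bop_one_subproof.

Lemma bop_mul_subproof (A B : bop) : bounded_linear_pred (A \o B).
Proof.
apply/asboolP; split=> [c x y|] /=; first by rewrite !bop_linear.
have [r rA] := bop_bounded A; have [s sB] := bop_bounded B.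
exists (`|r| * s) => x /=; rewrite rmorphM /= -mulrA.
apply: (le_trans (rA _)); apply: (@le_trans _ _ (`|r|%:C * `|B x|)).
  by rewrite ler_wpM2r// lecR ler_norm.
by rewrite ler_wpM2l// lecR.
Qed.

Definition bop_mul (A B : bop) : bop := Bop (bop_mul_subproof A B).

Lemma bop_mulA : associative bop_mul.
Proof. by move=> A B C; exact: bop_eqP. Qed.

Lemma bop_mul1l : left_id bop_one bop_mul.
Proof. by move=> A; exact: bop_eqP. Qed.

Lemma bop_mul1r : right_id bop_one bop_mul.
Proof. by move=> A; exact: bop_eqP. Qed.

Lemma bop_mulDl : left_distributive bop_mul +%R.
Proof. by move=> A B C; exact: bop_eqP. Qed.

Lemma bop_mulDr : right_distributive bop_mul +%R.
Proof.
move=> A B C; apply: bop_eqP => x /=.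
by have := bop_linear A 1 (B x) (C x); rewrite !scale1r.
Qed.

(* Only a pzRing: 0 = 1 is allowed, since H may be the zero space. *)
HB.instance Definition _ := GRing.Zmodule_isPzRing.Build bop
  bop_mulA bop_mul1l bop_mul1r bop_mulDl bop_mulDr.

Definition self_adjoint (A : bop) : Prop :=
  forall x y : H, hdot (A x) y = hdot x (A y).

(* In R[i], 0 <= z says that z is real and nonnegative. *)
Definition psd (A : bop) : Prop :=
  self_adjoint A /\ forall x : H, 0 <= hdot (A x) x.

Definition loewner (A B : bop) : Prop := psd (B - A).

Definition is_inverse (A B : bop) : Prop := B * A = 1 /\ A * B = 1.

(* The inverse in the algebra of bounded operators; junk value 0 when A is not
   invertible. *)
Definition opinv (A : bop) : bop := xget 0 [set B | is_inverse A B].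

Definition posop (A : bop) : Prop := psd A /\ exists B, is_inverse A B.

End BoundedOperators.

Notation "A <=L B" := (loewner A B) (at level 70, no associativity).

Definition prob_vector (R : realType) (n : nat) (w : 'I_n -> R) : Prop :=
  (forall i, 0 < w i) /\ \sum_(i < n) w i = 1.

Section OrderedMeans.
Variables (R : realType) (H : hilbertType R).

(* Families of n-variable maps, given as total functions; only their values at
   probability vectors and tuples of positive invertible operators matter. *)
Definition mean_family : Type :=
  forall n : nat, ('I_n -> R) -> ('I_n -> bop H) -> bop H.

Record ordered_mean (G : mean_family) : Prop := OrderedMean {
  om_posop : forall n (w : 'I_n -> R) (A : 'I_n -> bop H),
    prob_vector w -> (forall i, posop (A i)) -> posop (G n w A) ;
  om_homogeneous : forall n (w : 'I_n -> R) (A : 'I_n -> bop H) (a : R),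
    prob_vector w -> (forall i, posop (A i)) -> 0 < a ->
    G n w (fun i => a%:C *: A i) = a%:C *: G n w A ;
  om_monotone : forall n (w : 'I_n -> R) (A B : 'I_n -> bop H),
    prob_vector w ->
    (forall i, posop (A i)) -> (forall i, posop (B i)) ->
    (forall i, B i <=L A i) -> G n w B <=L G n w A ;
  om_concave : forall n (w : 'I_n -> R) (A B : 'I_n -> bop H) (s : R),
    prob_vector w ->
    (forall i, posop (A i)) -> (forall i, posop (B i)) ->
    0 <= s <= 1 ->
    (1 - s)%:C *: G n w A + s%:C *: G n w B
      <=L G n w (fun i => (1 - s)%:C *: A i + s%:C *: B i) ;
  om_harmonic_arithmetic : forall n (w : 'I_n -> R) (A : 'I_n -> bop H),
    prob_vector w -> (forall i, posop (A i)) ->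
    opinv (\sum_(i < n) (w i)%:C *: opinv (A i)) <=L G n w A /\
    G n w A <=L \sum_(i < n) (w i)%:C *: A i
}.

Definition param_mean_nneg (G : mean_family) (n : nat) (mu : R)
    (w : 'I_n -> R) (A : 'I_n -> bop H) : bop H :=
  G n w (fun i => A i + mu%:C *: (1 : bop H)) - mu%:C *: (1 : bop H).

Definition param_mean (G : mean_family) (n : nat) (mu : R)
    (w : 'I_n -> R) (A : 'I_n -> bop H) : bop H :=
  if 0 <= mu then param_mean_nneg G mu w A
  else opinv (param_mean_nneg G (- mu) w (fun i => opinv (A i))).

End OrderedMeans.

(* Main.v *)
Require Import Defs.
From HB Require Import structures.
From mathcomp Require Import all_boot all_order all_algebra complex.
From mathcomp Require Import all_classical all_reals all_analysis.
From mathcomp Require Import ring lra.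

(* Every ordered mean is superadditive, by concavity and homogeneity.  Hence
   G^nu lies between the harmonic and the arithmetic mean, and weighted
   arithmetic means of the G^{mu_i} satisfy a Jensen inequality in (A, mu)
   jointly.  The left-hand side of (i) is therefore at most the mean
   G^{w.mu} of the columnwise arithmetic means; the operator Kantorovich
   inequality bounds the latter by K times the columnwise harmonic means, hence
   by K G^nu, and superadditivity lets K >= 1 out of G^{w.mu}.  Part (ii) is
   part (i) for the inverses, which satisfy the bounds M^-1 and m^-1 and give
   the same K. *)

Import Order.TTheory GRing.Theory Num.Theory.
Import numFieldNormedType.Exports.
Local Open Scope complex_scope.
Local Open Scope classical_set_scope.
Local Open Scope ring_scope.

Set Implicit Arguments.
Unset Strict Implicit.
Unset Printing Implicit Defensive.

(** * Real inner product and real norm of a complex Hilbert space *)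

Section RealInnerProduct.
Variables (R : realType) (H : hilbertType R).
Implicit Types (x y z : H) (r : R).

Lemma hdotDl z x y : hdot (x + y) z = hdot x z + hdot y z.
Proof. exact: linearDl. Qed.

Lemma hdotDr z x y : hdot z (x + y) = hdot z x + hdot z y.
Proof. exact: linearDr. Qed.

Lemma hdotNl z x : hdot (- x) z = - hdot x z.
Proof. exact: linearNl. Qed.

Lemma hdotNr z x : hdot z (- x) = - hdot z x.
Proof. exact: linearNr. Qed.

Lemma hdotZl z (c : R[i]) x : hdot (c *: x) z = c * hdot x z.
Proof. exact: linearZl_LR. Qed.

Lemma hdotZr z r x : hdot z (r%:C *: x) = r%:C * hdot z x.
Proof.
transitivity (Num.conj r%:C * hdot z x); first exact: linearZr_LR.
by rewrite conj_Creal ?complex_real.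
Qed.

Lemma hdotC x y : hdot x y = Num.conj (hdot y x).
Proof. by rewrite -[RHS]mul1r; exact: hermC. Qed.

(** For a self-adjoint operator the form [hdot (A x) x] is real, so passing to real parts loses
    nothing and leaves inequalities in the ordered field [R]. *)
Definition ip x y : R := complex.Re (hdot x y).

Lemma ReD (a b : R[i]) : complex.Re (a + b) = complex.Re a + complex.Re b.
Proof. by case: a; case: b. Qed.

Lemma ReN (a : R[i]) : complex.Re (- a) = - complex.Re a.
Proof. by case: a. Qed.

Lemma ReMl r (a : R[i]) : complex.Re (r%:C * a) = r * complex.Re a.
Proof. by case: a => b c /=; rewrite mul0r subr0. Qed.

Lemma ipDl z x y : ip (x + y) z = ip x z + ip y z.
Proof. by rewrite /ip hdotDl ReD. Qed.

Lemma ipNl z x : ip (- x) z = - ip x z.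
Proof. by rewrite /ip hdotNl ReN. Qed.

Lemma ipZl z r x : ip (r%:C *: x) z = r * ip x z.
Proof. by rewrite /ip hdotZl ReMl. Qed.

Lemma ipC x y : ip x y = ip y x.
Proof. by rewrite /ip hdotC; case: (hdot y x). Qed.

Lemma ipDr z x y : ip z (x + y) = ip z x + ip z y.
Proof. by rewrite ipC ipDl !(ipC z). Qed.

Lemma ipNr z x : ip z (- x) = - ip z x.
Proof. by rewrite ipC ipNl (ipC z). Qed.

Lemma ipZr z r x : ip z (r%:C *: x) = r * ip z x.
Proof. by rewrite ipC ipZl (ipC z). Qed.

Lemma ip0l x : ip 0 x = 0.
Proof. by rewrite -(subrr x) ipDl ipNl subrr. Qed.

Definition ipE := (ipDl, ipDr, ipNl, ipNr, ipZl, ipZr).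

Definition rnorm x : R := complex.Re `|x|.

Lemma rnormE x : (rnorm x)%:C = `|x|.
Proof. exact: RRe_real (normr_real _). Qed.

Lemma rnorm_ge0 x : 0 <= rnorm x.
Proof. by rewrite -lecR rnormE normr_ge0. Qed.

Lemma ipxx x : ip x x = rnorm x ^+ 2.
Proof. by rewrite /ip hdot_norm -rnormE -rmorphXn. Qed.

Lemma ip_ge0 x : 0 <= ip x x.
Proof. by rewrite ipxx sqr_ge0. Qed.

Lemma ipxx_eq0 x : ip x x <= 0 -> x = 0.
Proof.
move=> x0; have : ip x x == 0 by rewrite eq_le x0 ip_ge0.
by rewrite ipxx expf_eq0 /= => /eqP x00; apply: normr0_eq0; rewrite -rnormE x00.
Qed.

End RealInnerProduct.

(** * The Loewner order on bounded operators *)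

Section Operators.
Variables (R : realType) (H : hilbertType R).
Implicit Types (A B C : bop H) (x y z : H) (r : R).

HB.instance Definition _ A :=
  GRing.isLinear.Build R[i] H H *:%R (bop_fun A) (bop_linear A).

Lemma bopDE A B x : (A + B) x = A x + B x. Proof. by []. Qed.
Lemma bopNE A x : (- A) x = - A x. Proof. by []. Qed.
Lemma bopZE (c : R[i]) A x : (c *: A) x = c *: A x. Proof. by []. Qed.
Lemma bop1E x : (1 : bop H) x = x. Proof. by []. Qed.
Lemma bopME A B x : (A * B) x = A (B x). Proof. by []. Qed.

Definition bopE := (bopDE, bopNE, bopZE, bop1E, bopME).

Lemma bop_D A x y : A (x + y) = A x + A y.
Proof. exact: linearD. Qed.

Lemma bop_N A x : A (- x) = - A x.
Proof. exact: linearN. Qed.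

Lemma bop_Z A (c : R[i]) x : A (c *: x) = c *: A x.
Proof. exact: linearZ. Qed.

Definition bopL := (bop_D, bop_N, bop_Z).

Lemma self_adjointD A B :
  self_adjoint A -> self_adjoint B -> self_adjoint (A + B).
Proof. by move=> a b x y; rewrite !bopE hdotDl hdotDr a b. Qed.

Lemma self_adjointN A : self_adjoint A -> self_adjoint (- A).
Proof. by move=> a x y; rewrite !bopE hdotNl hdotNr a. Qed.

Lemma self_adjointZ r A : self_adjoint A -> self_adjoint (r%:C *: A).
Proof. by move=> a x y; rewrite !bopE hdotZl hdotZr a. Qed.

Lemma self_adjoint1 : self_adjoint (1 : bop H).
Proof. by []. Qed.

Lemma ip_self_adjoint A x y : self_adjoint A -> ip (A x) y = ip x (A y).
Proof. by move=> a; rewrite /ip a. Qed.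

(** Self-adjointness and conjugate symmetry make the value equal to its own conjugate. *)
Lemma hdot_self_adjoint A x : self_adjoint A -> hdot (A x) x = (ip (A x) x)%:C.
Proof. by move=> a; rewrite /ip RRe_real// CrealE -hdotC a. Qed.

Lemma psdE A : psd A <-> self_adjoint A /\ forall x, 0 <= ip (A x) x.
Proof.
split=> -[a p]; split=> // x; have := p x.
  by rewrite hdot_self_adjoint// lecR.
by rewrite hdot_self_adjoint// lecR.
Qed.

Lemma psd_sa A : psd A -> self_adjoint A. Proof. by case. Qed.

Lemma psd_ip A x : psd A -> 0 <= ip (A x) x.
Proof. by move=> /psdE[]. Qed.

Lemma psd0 : psd (0 : bop H).
Proof.
by apply/psdE; split=> [x y|x]; rewrite /ip /= ?linear0l ?linear0r.
Qed.

Lemma psdD A B : psd A -> psd B -> psd (A + B).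
Proof.
move=> /psdE[a pa] /psdE[b pb]; apply/psdE; split; first exact: self_adjointD.
by move=> x; rewrite !bopE !ipE addr_ge0.
Qed.

Lemma psdZ r A : 0 <= r -> psd A -> psd (r%:C *: A).
Proof.
move=> r0 /psdE[a pa]; apply/psdE; split; first exact: self_adjointZ.
by move=> x; rewrite !bopE !ipE mulr_ge0.
Qed.

Lemma psd1 : psd (1 : bop H).
Proof. by apply/psdE; split=> // x; exact: ip_ge0. Qed.

Lemma loewner_refl A : A <=L A.
Proof. by rewrite /loewner subrr; exact: psd0. Qed.

Lemma loewner_trans B A C : A <=L B -> B <=L C -> A <=L C.
Proof. by move=> ab bc; have := psdD bc ab; rewrite addrA subrK. Qed.

Lemma loewnerD A A' B B' : A <=L B -> A' <=L B' -> A + A' <=L B + B'.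
Proof.
move=> ab ab'; rewrite /loewner opprD addrACA; exact: psdD.
Qed.

Lemma loewnerD2r C A B : A <=L B -> A + C <=L B + C.
Proof. by move=> ab; exact: loewnerD ab (loewner_refl C). Qed.

Lemma loewnerD2rI C A B : A + C <=L B + C -> A <=L B.
Proof. by rewrite /loewner opprD addrACA subrr addr0. Qed.

Lemma loewnerZ r A B : 0 <= r -> A <=L B -> r%:C *: A <=L r%:C *: B.
Proof. by move=> r0 ab; rewrite /loewner -scalerBr; exact: psdZ. Qed.

Lemma loewner_sum I (s : seq I) (A B : I -> bop H) :
  (forall i, A i <=L B i) -> \sum_(i <- s) A i <=L \sum_(i <- s) B i.
Proof.
move=> ab; elim/big_rec2: _ => [|i y x _ xy]; first exact: loewner_refl.
exact: loewnerD.
Qed.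

Lemma loewner_ip A B x : A <=L B -> ip (A x) x <= ip (B x) x.
Proof. by move=> /psd_ip-/(_ x); rewrite !bopE !ipE subr_ge0. Qed.

Lemma loewnerE A B : self_adjoint A -> self_adjoint B ->
  (forall x, ip (A x) x <= ip (B x) x) -> A <=L B.
Proof.
move=> a b ab; apply/psdE; split.
  by apply: self_adjointD => //; exact: self_adjointN.
by move=> x; rewrite !bopE !ipE subr_ge0.
Qed.

Lemma loewner_psd A B : psd A -> A <=L B -> psd B.
Proof. by move=> a ab; rewrite -[B](subrK A); exact: psdD. Qed.

(* Expand 0 <= <A (r x - A x), r x - A x>, using <A (A x), A x> <= r |A x|^2. *)
Lemma psd_image_le A r x : 0 < r -> psd A -> A <=L r%:C *: (1 : bop H) ->
  ip (A x) (A x) <= r * ip (A x) x.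
Proof.
move=> r0 pa ar.
have := psd_ip (r%:C *: x - A x) pa; have := loewner_ip (A x) ar.
rewrite !bopE !bopL !ipE.
rewrite (ip_self_adjoint (A x) x (psd_sa pa)) => h1 h2.
rewrite -(ler_pM2l r0); nra.
Qed.

End Operators.

(** * Invertibility of positive operators bounded below by a scalar *)

Section Inverse.
Variables (R : realType) (H : hilbertType R).
Implicit Types (A B C T : bop H) (x y z : H) (r q c : R).

(** Cauchy criterion, by comparison with the real geometric series and completeness of [H]. *)
Lemma geometric_series_cvg (u : H ^nat) r q : 0 <= q < 1 ->
  (forall k, rnorm (u k) <= r * q ^+ k) -> cvgn (series u).
Proof.
move=> /andP[q0 q1] ur.
have : cvgn (series (geometric r q)).
  by apply: is_cvg_geometric_series; rewrite ger0_norm.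
move=> /cauchy_cvgP/cauchy_seriesP rcvg.
apply/cauchy_cvgP/cauchy_seriesP => e e0.
(* Norms lie in [R[i]], hence so does [e]; being positive it is real, and the real Cauchy criterion
   applies to it. *)
have eE : (complex.Re e)%:C = e by apply: RRe_real; exact: gtr0_real.
have {}e0 : 0 < complex.Re e by rewrite -ltcR eE.
have := rcvg _ e0.
apply: filterS => n /= rn; rewrite -eE.
apply: le_lt_trans (ler_norm_sum _ _ _) _.
under eq_bigr do rewrite -rnormE.
rewrite -rmorph_sum /= ltcR; apply: le_lt_trans rn.
by apply: le_trans (ler_norm _); apply: ler_sum => k _; exact: ur.
Qed.

(** The solution is the Neumann series, the sum of all [T^k z]. *)
Lemma neumann_solution T q z : 0 <= q < 1 ->
  (forall x, rnorm (T x) <= q * rnorm x) -> exists x, x = T x + z.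
Proof.
move=> /andP[q0 q1] Tq.
pose u k := iter k T z.
have uq k : rnorm (u k) <= rnorm z * q ^+ k.
  elim: k => [|k ih]; first by rewrite mulr1.
  rewrite /u iterS (le_trans (Tq _))// exprS mulrCA ler_wpM2l//.
have /geometric_series_cvg : 0 <= q < 1 by rewrite q0.
move=> /(_ u _ uq) ucvg; pose p := limn (series u).
have SE n : series u n.+1 = T (series u n) + z.
  rewrite /series /= big_nat_recl//= addrC; congr (_ + _).
  by rewrite (big_morph _ (bop_D T) (linear0 _)).
exists p; apply/eqP; rewrite -subr_eq0 -normr_le0.
apply/ler_addgt0Pr => e e0; rewrite add0r.
have e20 : 0 < e / 2 by rewrite divr_gt0.
have /cvgrPdist_lt/(_ _ e20)[N _ Np] := ucvg.
have T1 x : `|T x| <= `|x|.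
  rewrite -!rnormE lecR (le_trans (Tq _))// ler_piMl ?rnorm_ge0 ?ltW//.
(* By [SE] the residual of the limit splits into two tails, each at most [e / 2] because [T] does
   not increase norms. *)
have -> : p - (T p + z) = (p - series u N.+1) - T (p - series u N).
  rewrite SE bop_D bop_N opprB !opprD -addrA; congr (_ + _).
  by rewrite [- T (series u N) - z]addrC addrA subrK addrC.
rewrite (splitr e) (le_trans (ler_normB _ _))// lerD//.
  by apply/ltW/Np; rewrite /= leqnSn.
by apply: (le_trans (T1 _)); exact/ltW/Np/leqnn.
Qed.

Lemma posop_sa A : posop A -> self_adjoint A.
Proof. by case=> /psd_sa. Qed.

(** From [|A x - x|^2 >= 0], twice [<A x, x>] is at most [|A x|^2 + |x|^2], hence at most
    [(s^2 + 1) |x|^2]. This constant is positive whatever the sign of [s]. *)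
Lemma bop_le_scalar A : psd A -> exists2 r, 0 < r & A <=L r%:C *: (1 : bop H).
Proof.
move=> pa; have [s sA] := bop_bounded A.
have {}sA x : rnorm (A x) <= s * rnorm x.
  by rewrite -lecR rnormE rmorphM /= rnormE.
have s2 : 0 <= s ^+ 2 by exact: sqr_ge0.
exists (s ^+ 2 + 1); first by lra.
apply: loewnerE; [exact: psd_sa|exact/self_adjointZ/self_adjoint1|move=> x].
have := ip_ge0 (A x - x); rewrite !bopE !ipE (ipC x) => h.
have : ip (A x) (A x) <= s ^+ 2 * ip x x.
  rewrite !ipxx -exprMn ler_sqr ?nnegrE ?rnorm_ge0//.
  exact: le_trans (rnorm_ge0 _) (sA x).
have := ip_ge0 x; nra.
Qed.

(** With [B] the inverse, [|x|^2 = |B (A x)|^2 <= s^2 |A x|^2 <= s^2 r <A x, x>]. The added 1 in the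
    witness keeps it defined when [s = 0]. *)
Lemma posop_ge_scalar A : posop A ->
  exists2 c, 0 < c & c%:C *: (1 : bop H) <=L A.
Proof.
move=> [pa [B [BA AB]]]; have [r r0 Ar] := bop_le_scalar pa.
have [s sB] := bop_bounded B.
have {}sB x : rnorm x ^+ 2 <= s ^+ 2 * rnorm (A x) ^+ 2.
  have := sB (A x); rewrite -bopME BA bop1E -!rnormE -rmorphM lecR => h.
  by rewrite -exprMn ler_sqr ?nnegrE ?rnorm_ge0// (le_trans _ h) ?rnorm_ge0.
have s2 : 0 <= s ^+ 2 by exact: sqr_ge0.
have sr : 0 < (s ^+ 2 + 1) * r by rewrite mulr_gt0//; lra.
exists ((s ^+ 2 + 1) * r)^-1; first by rewrite invr_gt0.
apply: loewnerE; [exact/self_adjointZ/self_adjoint1|exact: psd_sa|move=> x].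
rewrite !bopE !ipE mulrC ler_pdivrMr// -mulrCA mulrC ipxx -mulrA.
rewrite (le_trans (sB x))// -ipxx.
have := psd_image_le x r0 pa Ar; have := ip_ge0 (A x); nra.
Qed.

(* If A <= r, then 1 - t A is a strict contraction for t := (r + c)^-1, so that
   x = (1 - t A) x + t y has a solution, i.e. A x = y. *)
Lemma ge_scalar_posop A c : 0 < c -> psd A -> c%:C *: (1 : bop H) <=L A ->
  posop A.
Proof.
move=> c0 pa cA; split=> //.
have [r r0 Ar] := bop_le_scalar pa.
have cxA x : c * ip x x <= ip (A x) x.
  by have := loewner_ip x cA; rewrite !bopE !ipE.
(* Adding [c] to [r] makes [q = t r] strictly positive, as [psd_image_le] requires for the bound on
   [T]. *)
pose t := (r + c)^-1.
have t0 : 0 < t by rewrite invr_gt0 addr_gt0.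
have trc : t * (r + c) = 1 by rewrite mulVf// gt_eqF// addr_gt0.
pose q := 1 - t * c.
have qE : q = t * r by rewrite /q -trc; ring.
have q0 : 0 < q by rewrite qE mulr_gt0.
have q01 : 0 <= q < 1.
  have := mulr_gt0 t0 c0; have := mulr_gt0 t0 r0; rewrite /q => h1 h2; lra.
pose T : bop H := 1 - t%:C *: A.
have saT : self_adjoint T.
  apply: self_adjointD; first exact: self_adjoint1.
  exact/self_adjointN/self_adjointZ/psd_sa.
have pT : psd T.
  apply/psdE; split=> // x; rewrite !bopE !ipE.
  have := loewner_ip x Ar; rewrite !bopE !ipE => h.
  have := ip_ge0 x; have := mulr_gt0 t0 c0; nra.
have Tq x : rnorm (T x) <= q * rnorm x.
  have Tle : T <=L q%:C *: (1 : bop H).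
    apply: loewnerE => //; first exact/self_adjointZ/self_adjoint1.
    move=> y; rewrite !bopE !ipE /q mulrBl mul1r lerD2l lerN2 -mulrA.
    by rewrite ler_wpM2l// ltW.
  rewrite -ler_sqr ?nnegrE ?mulr_ge0 ?rnorm_ge0 ?(ltW q0)// exprMn -!ipxx.
  rewrite (le_trans (psd_image_le x q0 pT Tle))// expr2 -mulrA ler_pM2l//.
  by have := loewner_ip x Tle; rewrite !bopE !ipE.
have surj y : exists x, A x = y.
  have [x] := neumann_solution (t%:C *: y) q01 Tq.
  rewrite !bopE -addrA => /eqP; rewrite eq_sym -subr_eq0 addrAC subrr add0r.
  rewrite addrC -scalerBr scaler_eq0 => /orP[/eqP[t00]|].
    by move: t0; rewrite t00 ltxx.
  by rewrite subr_eq0 => /eqP yx; exists x.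
(* The inverse is chosen pointwise; its linearity follows from injectivity of [A]. *)
pose f y := projT1 (cid (surj y)).
have fK y : A (f y) = y by rewrite /f; case: cid.
have inj x y : A x = A y -> x = y.
  move=> Axy; apply/eqP; rewrite -subr_eq0; apply/eqP/ipxx_eq0.
  by have := cxA (x - y); rewrite bop_D bop_N Axy subrr ip0l pmulr_rle0.
have fP : bounded_linear_pred f.
  apply/asboolP; split=> [a x y|]; first by apply: inj; rewrite !bopL !fK.
  exists c^-1 => y; rewrite -!rnormE -rmorphM lecR ler_pdivlMl//.
  have := cxA (f y); rewrite fK => h.
  (* In place of Cauchy-Schwarz: with [c |f y|^2 <= <y, f y>], expanding this square gives
     [c^2 |f y|^2 <= |y|^2]. *)
  have := ip_ge0 (c%:C *: f y - y); rewrite !ipE (ipC _ y) => h2.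
  have c0' := ltW c0.
  rewrite -ler_sqr ?nnegrE ?mulr_ge0 ?rnorm_ge0// exprMn -!ipxx; nra.
exists (Bop fP); split; apply: bop_eqP => x; rewrite !bopE /=.
  by apply: inj; rewrite fK.
exact: fK.
Qed.

End Inverse.

(** * Operator inverses and the operator Kantorovich inequality *)

Section Kantorovich.
Variables (R : realType) (H : hilbertType R).
Implicit Types (A B C : bop H) (x y z : H) (r c : R).

Lemma is_inverse_uniq A B C : is_inverse A B -> is_inverse A C -> B = C.
Proof. by move=> [BA _] [_ CA]; rewrite -[B]mulr1 -CA mulrA BA mul1r. Qed.

(** [opinv] is picked by choice; uniqueness lets any exhibited inverse identify it. *)
Lemma is_inverse_opinv A B : is_inverse A B -> opinv A = B.
Proof. by move=> AB; exact: is_inverse_uniq (xgetI 0 AB) AB. Qed.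

Lemma opinvP A : posop A -> is_inverse A (opinv A).
Proof. by move=> [_ [B AB]]; rewrite (is_inverse_opinv AB). Qed.

Lemma opinvK A : posop A -> opinv (opinv A) = A.
Proof. by move=> /opinvP[BA AB]; exact: is_inverse_opinv. Qed.

Lemma opinv_appl A x : posop A -> opinv A (A x) = x.
Proof. by move=> /opinvP[BA _]; rewrite -bopME BA. Qed.

Lemma opinv_appr A x : posop A -> A (opinv A x) = x.
Proof. by move=> /opinvP[_ AB]; rewrite -bopME AB. Qed.

Lemma posop_opinv A : posop A -> posop (opinv A).
Proof.
move=> pA; have saA := posop_sa pA.
split; last by have [BA AB] := opinvP pA; exists A.
apply/psdE; split=> [x y|x].
  by rewrite -[y in LHS](opinv_appr y pA) -saA opinv_appr.
by rewrite ipC -[x in ip x _](opinv_appr x pA); exact: psd_ip pA.1.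
Qed.

Lemma opinvZ r A : 0 < r -> posop A -> opinv (r%:C *: A) = r^-1%:C *: opinv A.
Proof.
move=> r0 pA; have rr : r^-1 * r = 1 by rewrite mulVf// gt_eqF.
apply: is_inverse_opinv; split; apply: bop_eqP => x; rewrite !bopE bop_Z.
  by rewrite opinv_appl// scalerA -rmorphM rr scale1r.
by rewrite opinv_appr// scalerA -rmorphM mulrC rr scale1r.
Qed.

(** A positive scalar lower bound of [A] is inherited by [B], and such a bound forces
    invertibility. *)
Lemma loewner_posop A B : posop A -> A <=L B -> posop B.
Proof.
move=> pA AB; have [c c0 cA] := posop_ge_scalar pA.
apply: ge_scalar_posop c0 (loewner_psd pA.1 AB) (loewner_trans cA AB).
Qed.

Lemma posop_scalar r : 0 < r -> posop (r%:C *: (1 : bop H)).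
Proof.
move=> r0; apply: (ge_scalar_posop r0); last exact: loewner_refl.
exact: psdZ (ltW r0) (psd1 _).
Qed.

Lemma posopD_psd A B : posop A -> psd B -> posop (A + B).
Proof.
by move=> pA pB; apply: (loewner_posop pA); rewrite /loewner addrAC subrr add0r.
Qed.

Lemma posopZ r A : 0 < r -> posop A -> posop (r%:C *: A).
Proof.
move=> r0 pA; have [c c0 cA] := posop_ge_scalar pA.
apply: (loewner_posop (posop_scalar (mulr_gt0 r0 c0))).
by rewrite rmorphM -scalerA; apply: loewnerZ => //; exact: ltW.
Qed.

Lemma psd_sum I (s : seq I) (A : I -> bop H) :
  (forall i, psd (A i)) -> psd (\sum_(i <- s) A i).
Proof. by move=> pA; elim/big_ind: _ => //; [exact: psd0|exact: psdD]. Qed.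

(** The index set is nonempty because the empty sum 0 is invertible only on the zero space. *)
Lemma posop_sum n (A : 'I_n.+1 -> bop H) :
  (forall i, posop (A i)) -> posop (\sum_i A i).
Proof.
move=> pA; rewrite big_ord_recl; apply: posopD_psd => //.
by apply: psd_sum => i; exact: (pA _).1.
Qed.

(* Expand 0 <= <A (u - v), u - v> with u := B^-1 x and v := A^-1 x. *)
Lemma opinv_anti A B : posop A -> posop B -> A <=L B -> opinv B <=L opinv A.
Proof.
move=> pA pB AB.
apply: loewnerE; [exact/posop_sa/posop_opinv..|move=> x].
have := psd_ip (opinv B x - opinv A x) pA.1.
have := loewner_ip (opinv B x) AB.
rewrite bop_D bop_N !ipE !opinv_appr//.
rewrite (ip_self_adjoint (opinv B x) (opinv A x) (posop_sa pA)) opinv_appr//.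
rewrite !(ipC x); nra.
Qed.

Lemma opinv_scalar r : 0 < r ->
  opinv (r%:C *: (1 : bop H)) = r^-1%:C *: (1 : bop H).
Proof.
move=> r0.
apply: is_inverse_opinv; split; apply: bop_eqP => x; rewrite !bopE scalerA.
  by rewrite -rmorphM mulVf ?gt_eqF// scale1r.
by rewrite -rmorphM divff ?gt_eqF// scale1r.
Qed.

Lemma opinv_le_scalar A r : 0 < r -> posop A -> r%:C *: (1 : bop H) <=L A ->
  opinv A <=L r^-1%:C *: (1 : bop H).
Proof.
move=> r0 pA rA; rewrite -opinv_scalar//.
exact: opinv_anti (posop_scalar r0) pA rA.
Qed.

Lemma scalar_le_opinv A r : 0 < r -> posop A -> A <=L r%:C *: (1 : bop H) ->
  r^-1%:C *: (1 : bop H) <=L opinv A.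
Proof.
move=> r0 pA Ar; rewrite -opinv_scalar//.
exact: opinv_anti pA (posop_scalar r0) Ar.
Qed.

(* With S := M - A and T := A - m, the defect (M - A)(A - m)A^-1 multiplied by
   M - m = S + T is S (T A^-1) S + T (S A^-1) T, a sum of positive operators. *)
Lemma opinv_chord A (m M : R) : 0 < m -> 0 < M -> posop A ->
  m%:C *: (1 : bop H) <=L A -> A <=L M%:C *: (1 : bop H) ->
  A + (M * m)%:C *: opinv A <=L (M + m)%:C *: (1 : bop H).
Proof.
move=> m0 M0 pA mA AM.
have pB := posop_opinv pA; have saA := posop_sa pA; have saB := posop_sa pB.
have Bm x : m * ip (opinv A x) x <= ip x x.
  have := loewner_ip x (opinv_le_scalar m0 pA mA).
  by rewrite !bopE !ipE ler_pdivlMl.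
have BM x : ip x x <= M * ip (opinv A x) x.
  have := loewner_ip x (scalar_le_opinv M0 pA AM).
  by rewrite !bopE !ipE ler_pdivrMl.
apply: loewnerE.
- exact/self_adjointD/self_adjointZ.
- exact/self_adjointZ/self_adjoint1.
move=> x; rewrite !bopE !ipE.
(* The factor [M - m] cancels only when positive. If [M <= m], the bounds [<A x, x> <= M |x|^2] and
   [m <A^-1 x, x> <= |x|^2] already suffice. *)
have [Mm|mM] := leP M m.
  have := loewner_ip x AM; rewrite !bopE !ipE => AMx.
  have := Bm x; have := ip_ge0 x; nra.
(* Positivity of [T A^-1 = 1 - m A^-1] at [S x] and of [S A^-1 = M A^-1 - 1] at [T x]. *)
have := Bm (M%:C *: x - A x); have := BM (A x - m%:C *: x).
rewrite !bopL !ipE !opinv_appl//.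
rewrite (ip_self_adjoint x (A x) saB) opinv_appl// !(ipC x (A x)).
move=> h1 h2.
have c0 : 0 < M - m by rewrite subr_gt0.
rewrite -(ler_pM2l c0); nra.
Qed.

(* AM-GM: expand 0 <= <A^-1 y, y> with y := p A x - (s / 2) x. *)
Lemma opinv_AMGM A (p s : R) : 0 < p -> posop A ->
  s%:C *: (1 : bop H) <=L p%:C *: A + (s ^+ 2 / (4 * p))%:C *: opinv A.
Proof.
move=> p0 pA; have pB := posop_opinv pA.
have saA := posop_sa pA; have saB := posop_sa pB.
apply: loewnerE.
- exact/self_adjointZ/self_adjoint1.
- by apply: self_adjointD; exact: self_adjointZ.
move=> x; rewrite !bopE !ipE.
have := psd_ip (p%:C *: A x - (s / 2)%:C *: x) pB.1.
rewrite !bopL !ipE opinv_appl//.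
rewrite (ip_self_adjoint x (A x) saB) opinv_appl// (ipC x (A x)) => h.
rewrite -(ler_pM2l p0) mulrDr [p * (s ^+ 2 / _ * _)]mulrA.
have -> : p * (s ^+ 2 / (4 * p)) = s ^+ 2 / 4 by field; rewrite gt_eqF.
nra.
Qed.

Lemma prob_vector_card n (w : 'I_n -> R) : prob_vector w -> (0 < n)%N.
Proof.
case: n w => // w [_]; rewrite big_ord0 => /esym/eqP; by rewrite oner_eq0.
Qed.

Lemma prob_sum_const n (w : 'I_n -> R) A :
  prob_vector w -> \sum_i (w i)%:C *: A = A.
Proof.
by move=> [_ w1]; rewrite -scaler_suml -rmorph_sum /= w1 scale1r.
Qed.

Lemma posop_wsum n (w : 'I_n -> R) (A : 'I_n -> bop H) : prob_vector w ->
  (forall i, posop (A i)) -> posop (\sum_i (w i)%:C *: A i).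
Proof.
move=> wP pA; have := prob_vector_card wP.
case: n w A wP pA => // n w A [w0 _] pA _.
by apply: posop_sum => i; exact: posopZ.
Qed.

(** Averaging [opinv_chord] bounds the arithmetic mean plus [M m B] by [M + m]. By [opinv_AMGM] with
    [p = M m] and [s = M + m], the latter is at most [M m B] plus the right-hand side; then [M m B]
    cancels. *)
Lemma kantorovich n (w : 'I_n -> R) (A : 'I_n -> bop H) (m M : R) :
  prob_vector w -> 0 < m -> 0 < M -> (forall i, posop (A i)) ->
  (forall i, m%:C *: (1 : bop H) <=L A i) ->
  (forall i, A i <=L M%:C *: (1 : bop H)) ->
  \sum_i (w i)%:C *: A i <=L
  ((M + m) ^+ 2 / (4 * M * m))%:C *: opinv (\sum_i (w i)%:C *: opinv (A i)).
Proof.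
move=> wP m0 M0 pA mA AM; set B := \sum_i _ *: opinv _.
have pB : posop B by apply: posop_wsum => // i; exact: posop_opinv.
have Mm : 0 < M * m by rewrite mulr_gt0.
have h1 : \sum_i (w i)%:C *: A i + (M * m)%:C *: B <=L
          (M + m)%:C *: (1 : bop H).
  rewrite -(prob_sum_const ((M + m)%:C *: (1 : bop H)) wP).
  rewrite scaler_sumr -big_split /=.
  apply: loewner_sum => i.
  rewrite [_ *: (_ *: opinv _)]scalerA [X in X *: opinv _]mulrC.
  rewrite -scalerA -scalerDr.
  by apply: loewnerZ; [exact/ltW/wP.1|exact: opinv_chord].
have := loewner_trans h1 (opinv_AMGM (M + m) Mm pB).
by rewrite [_ *: B + _]addrC (mulrA 4) => /loewnerD2rI.
Qed.

End Kantorovich.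

(** * Ordered means and their parameterized versions *)

Section Means.
Variables (R : realType) (H : hilbertType R) (G : mean_family H).
Hypothesis hG : ordered_mean G.

Section OneMean.
Variables (n : nat) (w : 'I_n -> R).
Hypothesis wP : prob_vector w.
Implicit Types (A B : 'I_n -> bop H) (r mu nu : R).

(** Concavity at the midpoint of [2 A] and [2 B]; homogeneity removes the factors 2. *)
Lemma mean_superadditive A B :
  (forall i, posop (A i)) -> (forall i, posop (B i)) ->
  G w A + G w B <=L G w (fun i => A i + B i).
Proof.
move=> pA pB.
have two0 : 0 < 2 :> R by [].
have half : 2^-1 * 2 = 1 :> R by rewrite mulVf.
have := om_concave hG wP (A := fun i => 2%:C *: A i) (B := fun i => 2%:C *: B i)
  (s := 2^-1) (fun i => posopZ two0 (pA i)) (fun i => posopZ two0 (pB i)).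
have -> : 1 - 2^-1 = 2^-1 :> R by lra.
rewrite !(om_homogeneous hG)// !scalerA -rmorphM half !scale1r.
have -> : (fun i => 2^-1%:C *: (2%:C *: A i) + 2^-1%:C *: (2%:C *: B i)) =
          (fun i => A i + B i).
  by apply/funext => i; rewrite !scalerA -rmorphM half !scale1r.
by apply; apply/andP; split; lra.
Qed.

(** Superadditivity against the constant tuple [nu I], whose mean is at least [nu I] by the harmonic
    bound. *)
Lemma mean_shift A nu : 0 <= nu -> (forall i, posop (A i)) ->
  G w A + nu%:C *: (1 : bop H) <=L G w (fun i => A i + nu%:C *: (1 : bop H)).
Proof.
(* The case [nu = 0] is separate: the zero tuple is in general not positive invertible. *)
rewrite le_eqVlt => /predU1P[<-|nu0] pA.
  rewrite scale0r addr0 (_ : (fun i => _) = A); first exact: loewner_refl.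
  by apply/funext => i; rewrite addr0.
have pnu := posop_scalar H nu0.
apply: loewner_trans (mean_superadditive pA (fun=> pnu)).
apply: loewnerD; first exact: loewner_refl.
have [+ _] := om_harmonic_arithmetic hG wP (fun=> pnu).
by rewrite prob_sum_const// opinvK.
Qed.

Lemma posop_shift A nu : 0 <= nu -> (forall i, posop (A i)) ->
  forall i, posop (A i + nu%:C *: (1 : bop H)).
Proof. by move=> nu0 pA i; apply: posopD_psd => //; exact/psdZ/psd1. Qed.

Lemma mean_le_param A nu : 0 <= nu -> (forall i, posop (A i)) ->
  G w A <=L param_mean_nneg G nu w A.
Proof.
move=> nu0 pA; have := mean_shift nu0 pA.
by rewrite /loewner opprD addrA addrAC.
Qed.

Lemma posop_param A nu : 0 <= nu -> (forall i, posop (A i)) ->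
  posop (param_mean_nneg G nu w A).
Proof.
move=> nu0 pA; apply: loewner_posop (mean_le_param nu0 pA).
exact: om_posop.
Qed.

Lemma loewner_param A B nu : 0 <= nu ->
  (forall i, posop (A i)) -> (forall i, posop (B i)) ->
  (forall i, A i <=L B i) ->
  param_mean_nneg G nu w A <=L param_mean_nneg G nu w B.
Proof.
move=> nu0 pA pB AB; apply: loewnerD2r.
apply: om_monotone => //; [exact: posop_shift..|move=> i].
exact: loewnerD2r.
Qed.

Lemma param_le_arithmetic A nu : 0 <= nu -> (forall i, posop (A i)) ->
  param_mean_nneg G nu w A <=L \sum_i (w i)%:C *: A i.
Proof.
move=> nu0 pA; have [_] := om_harmonic_arithmetic hG wP (posop_shift nu0 pA).
under eq_bigr do rewrite scalerDr.
rewrite big_split /= prob_sum_const// => h.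
have := loewnerD2r (- (nu%:C *: (1 : bop H))) h.
by rewrite addrK.
Qed.

(** Shifting [r A + mu] by the nonnegative scalar [(r - 1) mu] yields [r (A + mu)], where
    homogeneity applies. *)
Lemma param_scale A r mu : 1 <= r -> 0 <= mu -> (forall i, posop (A i)) ->
  param_mean_nneg G mu w (fun i => r%:C *: A i) <=L
  r%:C *: param_mean_nneg G mu w A.
Proof.
move=> r1 mu0 pA; have r0 : 0 < r by lra.
have prA i : posop (r%:C *: A i) by exact: posopZ.
have rmu0 : 0 <= (r - 1) * mu by rewrite mulr_ge0// subr_ge0.
have := mean_shift rmu0 (posop_shift mu0 prA).
have -> : (fun i => r%:C *: A i + mu%:C *: (1 : bop H) +
                    ((r - 1) * mu)%:C *: (1 : bop H)) =
          (fun i => r%:C *: (A i + mu%:C *: (1 : bop H))).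
  apply/funext => i; rewrite scalerDr -addrA -scalerDl -rmorphD.
  rewrite scalerA -rmorphM.
  by congr (_ + _%:C *: _); ring.
rewrite (om_homogeneous hG)//; last exact: posop_shift.
move=> h; have := loewnerD2r (- ((r * mu)%:C *: (1 : bop H))) h.
rewrite /param_mean_nneg scalerBr scalerA -rmorphM -addrA -scalerBl -rmorphB.
by rewrite (_ : (r - 1) * mu - r * mu = - mu) ?rmorphN ?scaleNr//; ring.
Qed.

Lemma mean_superadditive_sum N (A : 'I_N.+1 -> 'I_n -> bop H) :
  (forall i j, posop (A i j)) ->
  \sum_i G w (A i) <=L G w (fun j => \sum_i A i j).
Proof.
elim: N A => [|N ih] A pA.
  rewrite big_ord1 (_ : (fun j => _) = A ord0); first exact: loewner_refl.
  by apply/funext => j; rewrite big_ord1.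
rewrite big_ord_recl.
have -> : (fun j => \sum_i A i j) =
          (fun j => A ord0 j + \sum_(i < N.+1) A (lift ord0 i) j).
  by apply/funext => j; rewrite big_ord_recl.
have pS j : posop (\sum_(i < N.+1) A (lift ord0 i) j) by exact: posop_sum.
apply: loewner_trans (mean_superadditive (pA ord0) pS).
by apply: loewnerD; [exact: loewner_refl|exact: ih].
Qed.

End OneMean.

(** Homogeneity moves each weight inside its mean and superadditivity merges the means; the shifts
    [w i * mu i] add up identically inside and outside. *)
Lemma param_jensen n k (w : 'I_n -> R) (l : 'I_k -> R) (mu : 'I_n -> R)
    (A : 'I_n -> 'I_k -> bop H) :
  prob_vector w -> prob_vector l -> (forall i, 0 <= mu i) ->
  (forall i j, posop (A i j)) ->
  \sum_i (w i)%:C *: param_mean_nneg G (mu i) l (A i) <=L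
  param_mean_nneg G (\sum_i w i * mu i) l (fun j => \sum_i (w i)%:C *: A i j).
Proof.
move=> wP lP mu0 pA; have := prob_vector_card wP.
case: n w mu A wP mu0 pA => // n w mu A wP mu0 pA _.
have w0 := wP.1.
under eq_bigr do rewrite /param_mean_nneg scalerBr scalerA -rmorphM.
rewrite sumrB -scaler_suml -rmorph_sum; apply: loewnerD2r.
have pAmu i j : posop ((w i)%:C *: (A i j + (mu i)%:C *: (1 : bop H))).
  by apply: posopZ => //; exact: posop_shift.
have := mean_superadditive_sum lP pAmu.
under eq_bigr => i _.
  rewrite (om_homogeneous hG lP (posop_shift (mu0 i) (pA i)) (w0 i)); over.
rewrite (_ : (fun j => \sum_i (w i)%:C *: (A i j + _)) =
  (fun j => \sum_i (w i)%:C *: A i j +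
            (\sum_i w i * mu i)%:C *: (1 : bop H)))//.
apply/funext => j; under eq_bigr do rewrite scalerDr scalerA -rmorphM.
by rewrite big_split /= -scaler_suml -rmorph_sum.
Qed.

(** The bounds are arguments so that the constant can also be taken at [M^-1] and [m^-1]. *)
Definition kantorovich_const (m M : R) : R := (M + m) ^+ 2 / (4 * M * m).

Lemma kantorovich_const_ge1 m M : 0 < m -> 0 < M -> 1 <= kantorovich_const m M.
Proof.
move=> m0 M0; rewrite ler_pdivlMr ?mul1r; last by rewrite !mulr_gt0.
by have := sqr_ge0 (M - m); nra.
Qed.

(** Stated for [param_mean_nneg] so that it serves both signs, the negative one through inverse
    blocks. *)
Lemma param_mean_exchange n k (A : 'I_n -> 'I_k -> bop H) (m M : R)
    (w : 'I_n -> R) (l : 'I_k -> R) (mu : 'I_n -> R) (nu : R) :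
  0 < m -> 0 < M -> (forall i j, posop (A i j)) ->
  (forall i j, m%:C *: (1 : bop H) <=L A i j) ->
  (forall i j, A i j <=L M%:C *: (1 : bop H)) ->
  prob_vector w -> prob_vector l -> (forall i, 0 <= mu i) -> 0 <= nu ->
  param_mean_nneg G nu w (fun i => param_mean_nneg G (mu i) l (A i)) <=L
  (kantorovich_const m M)%:C *:
    param_mean_nneg G (\sum_i w i * mu i) l
      (fun j => param_mean_nneg G nu w (fun i => A i j)).
Proof.
move=> m0 M0 pA mA AM wP lP mu0 nu0.
have K1 := kantorovich_const_ge1 m0 M0.
have K0 : 0 < kantorovich_const m M by exact: lt_le_trans K1.
have wmu0 : 0 <= \sum_i w i * mu i.
  by apply: sumr_ge0 => i _; rewrite mulr_ge0// ltW// wP.1.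
have pcol j : posop (param_mean_nneg G nu w (fun i => A i j)).
  by apply: posop_param.
apply: loewner_trans (param_le_arithmetic wP nu0 _) _.
  by move=> i; exact: posop_param.
apply: loewner_trans (param_jensen wP lP mu0 pA) _.
(* With the constant moved inside the outer mean, monotonicity leaves one comparison per column. *)
apply: loewner_trans (param_scale lP K1 wmu0 pcol).
apply: loewner_param => // [j|j|j]; [exact: posop_wsum|exact: posopZ|].
apply: loewner_trans (kantorovich wP m0 M0 _ _ _) _ => //.
apply: loewnerZ; first exact: ltW.
apply: loewner_trans (mean_le_param wP nu0 _) => //.
by have [] := om_harmonic_arithmetic hG wP (fun i => pA i j).
Qed.

End Means.

(** * Exchange inequalities for nonnegative and for negative parameters *)

Theorem theorem3p5 (R : realType) (H : hilbertType R)
    (G : mean_family H) (hG : ordered_mean G)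
    (n k : nat) (A : 'I_n -> 'I_k -> bop H) (m M : R)
    (m_gt0 : 0 < m) (M_gt0 : 0 < M)
    (A_pos : forall i j, posop (A i j))
    (A_ge : forall i j, m%:C *: (1 : bop H) <=L A i j)
    (A_le : forall i j, A i j <=L M%:C *: (1 : bop H))
    (w : 'I_n -> R) (w_prob : prob_vector w)
    (l : 'I_k -> R) (l_prob : prob_vector l) :
  let K : R := (M + m) ^+ 2 / (4 * M * m) in
  (forall (mu : 'I_n -> R) (nu : R), (forall i, 0 <= mu i) -> 0 <= nu ->
     param_mean G nu w (fun i => param_mean G (mu i) l (fun j => A i j))
       <=L K%:C *: param_mean G (\sum_(i < n) w i * mu i) l
                     (fun j => param_mean G nu w (fun i => A i j))) /\
  (forall (mu : 'I_n -> R) (nu : R), (forall i, mu i < 0) -> nu < 0 ->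
     (K^-1)%:C *: param_mean G (\sum_(i < n) w i * mu i) l
                    (fun j => param_mean G nu w (fun i => A i j))
       <=L param_mean G nu w (fun i => param_mean G (mu i) l (fun j => A i j))).
Proof.
move=> K; have K0 : 0 < K.
  exact: lt_le_trans (kantorovich_const_ge1 m_gt0 M_gt0).
split=> mu nu mu0 nu0.
  have -> : (fun i => param_mean G (mu i) l (fun j => A i j)) =
            (fun i => param_mean_nneg G (mu i) l (A i)).
    by apply/funext => i; rewrite /param_mean mu0.
  rewrite /param_mean nu0 ifT; first exact: param_mean_exchange.
  by apply: sumr_ge0 => i _; rewrite mulr_ge0// ltW// w_prob.1.
have nmu i : 0 <= - mu i by rewrite oppr_ge0 ltW.
have nnu : 0 <= - nu by rewrite oppr_ge0 ltW.
have pB i j : posop (opinv (A i j)) by exact: posop_opinv.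
(* For negative parameters the outer mean inverts the inner ones, which are themselves inverses of
   [row] and [col], so the two inversions cancel. *)
pose row i := param_mean_nneg G (- mu i) l (fun j => opinv (A i j)).
pose col j := param_mean_nneg G (- nu) w (fun i => opinv (A i j)).
have prow i : posop (row i) by exact: posop_param.
have pcol j : posop (col j) by exact: posop_param.
(* Strictness needs [0 < n]: an empty sum would select the nonnegative branch of [param_mean]. *)
have wmu : \sum_i w i * mu i < 0.
  have := prob_vector_card w_prob.
  case: n w mu w_prob mu0 {A A_pos A_ge A_le nmu pB row col prow pcol} =>
    // n' w' mu' w'P mu'0 _.
  rewrite big_ord_recl -[X in _ < X]addr0 ltr_leD//.
    by rewrite pmulr_rlt0// w'P.1.
  by apply: sumr_le0 => i _; rewrite pmulr_rle0 ?w'P.1// ltW.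
have nwmu : 0 <= - \sum_i w i * mu i by rewrite oppr_ge0 ltW.
have rowE : (fun i => opinv (param_mean G (mu i) l (fun j => A i j))) = row.
  apply/funext => i; rewrite /param_mean leNgt mu0 /= opinvK//; exact: prow.
have colE : (fun j => opinv (param_mean G nu w (fun i => A i j))) = col.
  apply/funext => j; rewrite /param_mean leNgt nu0 /= opinvK//; exact: pcol.
rewrite [X in _ *: X]/param_mean [X in _ <=L X]/param_mean !leNgt wmu nu0 /=.
rewrite rowE colE.
have Prow := posop_param hG w_prob nnu prow.
have Pcol := posop_param hG l_prob nwmu pcol.
(* Both sides are now inverses, with [K^-1] absorbed, so antitonicity of inversion reverses the
   inequality. *)
rewrite -opinvZ//; apply: opinv_anti => //; first exact: posopZ.
have -> : - (\sum_i w i * mu i) = \sum_i w i * - mu i.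
  by rewrite -sumrN; apply: eq_bigr => i _; rewrite mulrN.
(* Inversion turns the bounds [m], [M] into [M^-1], [m^-1], which leave the constant unchanged. *)
have -> : K = kantorovich_const M^-1 m^-1.
  by rewrite /K /kantorovich_const; field; rewrite !gt_eqF// addr_gt0.
apply: param_mean_exchange; rewrite ?invr_gt0// => i j.
  exact: scalar_le_opinv.
exact: opinv_le_scalar.
Qed.
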